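(* Let $\phi : \mathbb{R} \to \mathbb{R}$ be a decreasing convex function, let $c \leq d$ be real numbers, and let $a, b \in [c,d]$ be such that $a+b > c+d$. Then $$\phi(a)+\phi(b) \leq \phi(c)+\phi(d).$$
   Context: A function $\phi : \mathbb{R} \to \mathbb{R}$ is convex if $\phi(\lambda x + (1-\lambda) y) \leq \lambda \phi(x) + (1-\lambda)\phi(y)$ for all $x,y \in \mathbb{R}$ and $0 \leq \lambda \leq 1$. Decreasing means that $x \leq y$ implies $\phi(x) \geq \phi(y)$. *)

(* Defs.v *)
From mathcomp Require Export all_boot all_order all_algebra.
From mathcomp Require Export mathcomp_extra boolp classical_sets reals.
From mathcomp Require Export interval_inference convex numfun.

(* Main.v *)
Require Import Defs.
From mathcomp Require Import ring lra.
Import Order.TTheory GRing.Theory Num.Theory.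
Local Open Scope classical_set_scope.
Local Open Scope ring_scope.

(* Write a = t c + (1 - t) d; then c + d - a = (1 - t) c + t d, and adding the
   two convexity inequalities gives phi a + phi (c + d - a) <= phi c + phi d.
   Since b > c + d - a, monotonicity gives phi b <= phi (c + d - a). *)

(** Replaces the bundled weight in [[0, 1]] and the abstract convex combination by plain ring
    expressions, ready for linear arithmetic. *)
Lemma convex_function_real (R : realFieldType) (f : R -> R) (t x y : R) :
    convex_function [set: R^o] f -> 0 <= t -> t <= 1 ->
  f (t * x + (1 - t) * y) <= t * f x + (1 - t) * f y.
Proof.
by move=> fconv t0 t1; apply: (fconv (Itv01 t0 t1) x y); rewrite inE.
Qed.

Lemma convex_function_reflect (R : realFieldType) (f : R -> R) (c d a : R) :
    convex_function [set: R^o] f -> a \in `[c, d] ->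
  f a + f (c + d - a) <= f c + f d.
Proof.
move=> fconv; rewrite in_itv /= => /andP[ca ad].
(* The weight [t] below divides by [d - c], so the degenerate interval is split off: there
   [c <= a <= d <= c] and both sides agree. *)
have [cd|dc] := ltP c d; last first.
  have -> : a = c by lra.
  by rewrite addrAC subrr add0r.
have cd0 : d - c != 0 by rewrite subr_eq0 gt_eqF.
pose t := (d - a) / (d - c).
have t0 : 0 <= t by rewrite divr_ge0 // subr_ge0 // ltW.
have t1 : t <= 1 by rewrite ler_pdivrMr ?subr_gt0 // mul1r lerD2l lerN2.
have -> : c + d - a = t * d + (1 - t) * c by rewrite /t; field.
have -> : f a = f (t * c + (1 - t) * d) by congr f; rewrite /t; field.
(* Same weight, endpoints swapped: in the sum, [f c] and [f d] each get total weight
   [t + (1 - t) = 1]. *)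
have := convex_function_real _ _ _ c d fconv t0 t1.
have := convex_function_real _ _ _ d c fconv t0 t1.
lra.
Qed.

Theorem theorem3p5 (R : realType) (phi : R -> R)
    (phi_decr : nonincreasing_fun phi)
    (phi_convex : convex_function [set: R^o] phi)
    (c d a b : R) (hcd : c <= d)
    (ha : a \in `[c, d]) (hb : b \in `[c, d])
    (hab : a + b > c + d) :
  phi a + phi b <= phi c + phi d.
Proof.
apply: le_trans (convex_function_reflect _ _ _ _ _ phi_convex ha).
by rewrite lerD2l; apply: phi_decr; rewrite lerBlDl ltW.
Qed.
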